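(* Let $f$ be a (possibly non-convex) function on the convex set $Q$, let $\delta,\mu,m\ge 0$, and suppose that $\psi_\delta(x,y)$ (with the associated values $f_\delta(y)$) is a $(\delta,L,\mu,m,V)$-model of $f$ at every point $y$. Let $x_*$ be a minimizer of $f$ on $Q$. Let $\{x_k\}$, $\{L_k\}$ be generated by the adaptive gradient method described in the context, with auxiliary accuracy $\widetilde\delta\ge 0$ and starting point $x_0$. Let $y_N=x_{j(N)}$, where $j(N)\in\operatorname{argmin}_{k=1,\dots,N} f_\delta(x_k)$. Define $q_k=\frac{L_k-\mu}{L_k+m}$ if $L_k>\mu$ and $q_k=0$ if $L_k\le\mu$, and $Q_j^k=\prod_{i=j}^k q_i$, with $Q_j^k=1$ for $j>k$. Then after $N\ge 1$ iterations $$f(y_N)-f(x_* )\le \min\left\{(L_N+m)\,Q_1^N,\ \frac{1}{\sum_{i=1}^N\frac{1}{L_i+m}}\right\}V[x_0](x_* )+\widetilde\delta+3\delta,$$ $$V[x_N](x_* )\le Q_1^N\,V[x_0](x_* )+(\widetilde\delta+2\delta)\sum_{i=1}^N\frac{Q_{i+1}^N}{L_i+m}.$$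
   Context: $Q$ is a convex subset of a finite-dimensional real vector space $E$ and the problem is $\min_{x\in Q}f(x)$. $d$ is a convex function on $Q$, continuously differentiable on the relative interior $\mathrm{ri}\,Q$, and $V[y](x)=d(x)-d(y)-\langle\nabla d(y),x-y\rangle$ for $x\in Q$, $y\in\mathrm{ri}\,Q$ is its Bregman divergence ($d$ need not be strongly convex). Whenever $V[y](x)$ is written, $y$ is understood to be a point for which it is defined; in particular the iterates are assumed to be such points. Model: for $\delta,L,\mu,m\ge0$, $\psi_\delta(x,y)$ is a $(\delta,L,\mu,m,V)$-model of $f$ at $y$, with associated number $f_\delta(y)$, if for all $x\in Q$ $$\mu V[y](x)\le f(x)-\left(f_\delta(y)+\psi_\delta(x,y)\right)\le LV[y](x)+\delta,$$ $\psi_\delta(x,y)$ is convex in $x$, $\psi_\delta(x,x)=0$ for all $x\in Q$, and $\psi(\cdot)=\psi_\delta(\cdot,y)$ satisfies $\psi(x)\ge\psi(z)+\langle g,x-z\rangle+mV[z](x)$ for all $x,z\in Q$ and all $g\in\partial\psi(z)$. Inexact minimization: for convex $\Psi$ and $\widetilde\delta\ge0$, $\operatorname{argmin}^{\widetilde\delta}_{x\in Q}\Psi(x)$ denotes some point $\widetilde x\in Q$ for which there exists $h\in\partial\Psi(\widetilde x)$ with $\langle h,x-\widetilde x\rangle\ge-\widetilde\delta$ for all $x\in Q$. Adaptive gradient method: input $x_0$, $\delta$, $L_0>0$. For $k=0,1,2,\dots$: find the smallest integer $i_k\ge0$ such that, with $L_{k+1}=2^{i_k-1}L_k$ and $$x_{k+1}=\operatorname{argmin}^{\widetilde\delta}_{x\in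 Q}\{\psi_\delta(x,x_k)+L_{k+1}V[x_k](x)\},$$ one has $$f_\delta(x_{k+1})\le f_\delta(x_k)+\psi_\delta(x_{k+1},x_k)+L_{k+1}V[x_k](x_{k+1})+\delta.$$ *)

(* Defs.v *)
From HB Require Import structures.
From mathcomp Require Import all_boot all_order all_algebra.
From mathcomp Require Import all_classical all_reals all_analysis.

Set Implicit Arguments.
Unset Strict Implicit.
Unset Printing Implicit Defensive.

Import Order.TTheory GRing.Theory Num.Theory.
Import numFieldNormedType.Exports.

Local Open Scope classical_set_scope.
Local Open Scope ring_scope.

(* Finite-dimensional real vector spaces, carrying some norm. The norm serves
   only to provide the topology, which in finite dimension does not depend on
   it: it is used in [relint] and [C1_relint] and nowhere else. *)
#[short(type="normedVectType")]
HB.structure Definition NormedVect (R : realType) :=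
  {E of NormedModule R E & Vector R E}.

Section convex_analysis.
Context {R : realType} {E : normedVectType R}.
Implicit Types (Q : set E) (d Psi : E -> R).

Definition dual : Type := 'Hom(E, R^o).

Definition pairing (g : dual) (v : E) : R := g v.

Definition affine_hull Q : set E :=
  [set z | exists n (p : 'I_n -> E) (c : 'I_n -> R),
     [/\ forall i, Q (p i), \sum_i c i = 1 & z = \sum_i c i *: p i]].

Definition relint Q : set E :=
  [set x | Q x /\ \forall z \near x, affine_hull Q z -> Q z].

(* [d] is continuously differentiable on ri Q with gradient [G], everything
   being relative to the affine hull of [Q]. When [Q] is not full-dimensional,
   [G y] is determined only on the direction of that hull, which is spanned by
   the differences [x - z] with x, z in Q; continuity of [G] is therefore
   required in those directions only. Values of [d] outside [Q] are
   irrelevant. *)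
Definition C1_relint Q d (G : E -> dual) : Prop :=
  (forall y, relint Q y -> forall e : R, 0 < e ->
     \forall x \near y, Q x ->
       `|d x - d y - pairing (G y) (x - y)| <= e * `|x - y|) /\
  (forall x z, Q x -> Q z ->
     {within relint Q, continuous (fun y => pairing (G y) (x - z))}).

(* V[y](x), to be used for x in Q and y in ri Q. *)
Definition bregman d (G : E -> dual) (y x : E) : R :=
  d x - d y - pairing (G y) (x - y).

(* Subdifferential at a point z of Q, for [Psi] regarded as a function on Q. *)
Definition subdifferential Q Psi (z : E) : set dual :=
  [set g | forall x, Q x -> Psi z + pairing g (x - z) <= Psi x].

(* The set of admissible values of argmin^{dt}_{x in Q} Psi(x). *)
Definition inexact_argmin Q Psi (dt : R) : set E :=
  [set z | Q z /\ exists2 h, subdifferential Q Psi z h &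
     forall x, Q x -> - dt <= pairing h (x - z)].

End convex_analysis.

Arguments dual {R} E.

Section method.
Context {R : realType} {E : normedVectType R}.
Implicit Types (Q : set E) (d f fdelta : E -> R) (G : E -> dual E).
Implicit Types (psi : E -> E -> R) (y : E).

(* [psi x y] is a (delta, L, mu, m, V)-model of [f] at [y], with associated
   number [fdelta y], for V the Bregman divergence of [d]. The last condition
   ranges over those z for which V[z] is defined. *)
Record is_model Q d G (delta L mu m : R) f fdelta psi y : Prop := IsModel {
  model_bounds : forall x, Q x ->
    mu * bregman d G y x <= f x - (fdelta y + psi x y)
      <= L * bregman d G y x + delta ;
  model_convex : convex_function Q (psi^~ y) ;
  model_diag : forall x, Q x -> psi x x = 0 ;
  model_strong : forall x z g, Q x -> relint Q z ->
    subdifferential Q (psi^~ y) z g ->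
    psi z y + pairing g (x - z) + m * bregman d G z x <= psi x y }.

(* One iteration, from (xk, Lk) to (xk', Lk'). [z j] is the inexact minimizer
   computed in the j-th trial, with trial constant 2^(j-1) Lk, and [i] is the
   first trial that is accepted. *)
Definition agm_step Q d G (delta dt : R) fdelta psi
    (xk : E) (Lk : R) (xk' : E) (Lk' : R) : Prop :=
  let trialL (j : nat) := (2 : R) ^ (j%:Z - 1) * Lk in
  let accepted (M : R) (z : E) :=
    fdelta z <= fdelta xk + psi z xk + M * bregman d G xk z + delta in
  exists (i : nat) (z : nat -> E),
    [/\ forall j, (j <= i)%N ->
          inexact_argmin Q
            (fun x => psi x xk + trialL j * bregman d G xk x) dt (z j),
        accepted (trialL i) (z i),
        forall j, (j < i)%N -> ~ accepted (trialL j) (z j),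
        xk' = z i &
        Lk' = trialL i].

(* [N] iterations of the adaptive gradient method from x 0 and L_0 = Ls 0. *)
Definition agm_run Q d G (delta dt : R) fdelta psi
    (x : nat -> E) (Ls : nat -> R) (N : nat) : Prop :=
  [/\ 0 < Ls 0%N,
      forall k, (k <= N)%N -> relint Q (x k) &
      forall k, (k < N)%N ->
        agm_step Q d G delta dt fdelta psi (x k) (Ls k) (x k.+1) (Ls k.+1)].

Definition qfactor (mu m : R) (Ls : nat -> R) (k : nat) : R :=
  if mu < Ls k then (Ls k - mu) / (Ls k + m) else 0.

(* Q_j^k *)
Definition qprod (mu m : R) (Ls : nat -> R) (j k : nat) : R :=
  \prod_(j <= i < k.+1) qfactor mu m Ls i.

End method.

(* Main.v *)
(* Each iterate satisfies
     (L_(k+1) + m) V[x_(k+1)](x) <= (L_(k+1) - mu) V[x_k](x)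
                                    + f(x) - f_delta(x_(k+1)) + dt + delta,
   obtained by combining the acceptance test, the inexact optimality condition,
   the three-point identity for V and the model inequalities. At x = xstar, where
   f(xstar) - f_delta(x_k) <= delta, a discrete Gronwall argument gives the bound
   on V[x_N](xstar). Bounding f_delta(x_k) from below by f_delta(y_N) instead, and
   replacing q_k by 1 or keeping only the last term of the Gronwall sum, gives
   the two bounds on f(y_N) - f(xstar). *)

Require Import Defs.
From mathcomp Require Import all_boot all_order all_algebra.
From mathcomp Require Import all_classical all_reals all_analysis.
From mathcomp Require Import ring lra.

Set Implicit Arguments.
Unset Strict Implicit.
Unset Printing Implicit Defensive.

Import Order.TTheory GRing.Theory Num.Theory.
Import numFieldNormedType.Exports.

Local Open Scope classical_set_scope.
Local Open Scope ring_scope.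

(** Unrolling the recursion, the source [s i] is damped by the later factors [q i.+1, ..., q n]
    only. Nonnegativity of [q] lets each step multiply the previous bound. *)
Lemma discrete_gronwall {R : numDomainType} (q s V : nat -> R) (n : nat) :
  (forall i, (i < n)%N -> 0 <= q i.+1) ->
  (forall i, (i < n)%N -> V i.+1 <= q i.+1 * V i + s i.+1) ->
  V n <= \prod_(1 <= i < n.+1) q i * V 0%N
         + \sum_(1 <= i < n.+1) \prod_(i.+1 <= k < n.+1) q k * s i.
Proof.
elim: n => [_ _|n IHn q_ge0 VS]; first by rewrite !big_geq // mul1r addr0.
have IH := IHn (fun i lti => q_ge0 i (leqW lti)) (fun i lti => VS i (leqW lti)).
apply: (le_trans (VS n (ltnSn n))).
apply: (le_trans (lerD (ler_wpM2l (q_ge0 n (ltnSn n)) IH) (lexx _))).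
rewrite [\prod_(1 <= i < n.+2) q i]big_nat_recr //=.
rewrite [\sum_(1 <= i < n.+2) _]big_nat_recr //= [\prod_(n.+2 <= k < n.+2) q k]big_geq //.
rewrite mul1r mulrDr mulrA [q n.+1 * _]mulrC -addrA lerD2l lerD2r.
rewrite big_distrr /= le_eqVlt; apply/orP; left; apply/eqP.
apply: eq_big_nat => i /andP[_ ltin].
by rewrite [in RHS]big_nat_recr //= mulrA [q n.+1 * _]mulrC.
Qed.

Section bregman_model.
Context {R : realType} {E : normedVectType R}.
Implicit Types (Q : set E) (d f fdelta Psi : E -> R) (G : E -> dual E).
Implicit Types (x y z v w : E) (t : R).

Lemma pairingD (g : dual E) v w : pairing g (v + w) = pairing g v + pairing g w.
Proof. exact: linearD. Qed.

Lemma pairingB (g : dual E) v w : pairing g (v - w) = pairing g v - pairing g w.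
Proof. exact: linearB. Qed.

Lemma pairingZ (g : dual E) t v : pairing g (t *: v) = t * pairing g v.
Proof. exact: linearZ. Qed.

(** Connects real coefficients with the type [{i01 R}] over which [convex_set] and [convex_function]
    quantify. *)
Lemma i01_num t : 0 <= t <= 1 -> exists p : {i01 R}, p%:num = t.
Proof.
move=> t01; have t01' : Itv.spec (@Itv.num_sem R) (Itv.Real `[0%Z, 1%Z]) t.
  by rewrite /= /Itv.num_sem /= num_real /= in_itv.
by exists (Itv.mk t01').
Qed.

Lemma convex_set_segment Q x z t :
  convex_set Q -> Q x -> Q z -> 0 <= t <= 1 -> Q (z + t *: (x - z)).
Proof.
move=> Qconv Qx Qz /i01_num[p pt].
have := Qconv x z p (mem_set Qx) (mem_set Qz).
rewrite inE /conv /= /unstable.onem pt scalerBl scale1r.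
by congr (Q _); rewrite scalerBr addrCA.
Qed.

Lemma convex_function_segment Q Psi x z t :
  convex_function Q Psi -> Q x -> Q z -> 0 <= t <= 1 ->
  Psi (z + t *: (x - z)) <= Psi z + t * (Psi x - Psi z).
Proof.
move=> Pconv Qx Qz /i01_num[p pt].
have := Pconv p x z (mem_set Qx) (mem_set Qz).
rewrite convRE /conv /= /unstable.onem pt scalerBl scale1r.
rewrite scalerBr addrCA => /le_trans; apply.
by rewrite le_eqVlt; apply/orP; left; apply/eqP; ring.
Qed.

(** One step length [t] per tolerance [e] is enough: convexity compares values along the segment,
    and dividing by [t] leaves an arbitrary error [e]. *)
Lemma C1_relint_segment Q d G x y (e : R) :
  convex_set Q -> C1_relint Q d G -> relint Q y -> Q x -> 0 < e ->
  exists2 t, 0 < t <= 1 &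
    `|d (y + t *: (x - y)) - d y - t * pairing (G y) (x - y)| <= e * t.
Proof.
move=> Qconv [dG _] riy Qx e0.
(* The summand 1 keeps [c] positive when [x = y]. Tolerance [e / c] then yields error at most
   [e * t], and the factor 1/2 in [t] puts the point strictly inside the ball of radius [r]. *)
set c := `|x - y| + 1.
have c0 : 0 < c by rewrite ltr_wpDl.
have /nbhs_ballP [r /= r0 yr] := dG y riy (e / c) (divr_gt0 e0 c0).
exists (Num.min 1 (r / c / 2)).
  by rewrite lt_min ltr01 !divr_gt0 //= ge_min lexx.
set t := Num.min _ _.
have t0 : 0 < t by rewrite lt_min ltr01 !divr_gt0.
have t1 : t <= 1 by rewrite ge_min lexx.
have tr : t <= r / c / 2 by rewrite ge_min lexx orbT.
have Qt : Q (y + t *: (x - y)).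
  by apply: convex_set_segment => //; [case: riy|rewrite (ltW t0)].
have nt : `|t *: (x - y)| <= t * c.
  by rewrite normrZ (gtr0_norm t0) ler_pM2l // lerDl.
have near_y : ball y r (y + t *: (x - y)).
  rewrite -ball_normE /= opprD addrA subrr sub0r normrN.
  apply: (le_lt_trans nt); rewrite -ltr_pdivlMr //.
  by apply: (le_lt_trans tr); rewrite ltr_pdivrMr // ltr_pMr ?divr_gt0 // ltr1n.
have := yr _ near_y Qt.
rewrite [_ + _ *: _ - y]addrAC subrr add0r pairingZ => /le_trans; apply.
apply: (le_trans (ler_wpM2l (ltW (divr_gt0 e0 c0)) nt)).
by rewrite [t * c]mulrC mulrA divfK // gt_eqF.
Qed.

Lemma bregman_ge0 Q d G x y :
  convex_set Q -> convex_function Q d -> C1_relint Q d G ->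
  relint Q y -> Q x -> 0 <= bregman d G y x.
Proof.
move=> Qconv dconv dG riy Qx; have Qy : Q y by case: riy.
rewrite /bregman subr_ge0; apply/ler_addgt0Pr => e e0.
have [t /andP[t0 t1] dt] := C1_relint_segment Qconv dG riy Qx e0.
have t01 : 0 <= t <= 1 by rewrite (ltW t0).
have := convex_function_segment dconv Qx Qy t01.
move: dt; rewrite ler_norml => /andP[dt _] dle; rewrite -(ler_pM2l t0).
by move: dt dle; lra.
Qed.

Lemma bregman_diag d G x : bregman d G x x = 0.
Proof. by rewrite /bregman !subrr /pairing linear0 subr0. Qed.

Lemma bregman_three_point d G x y z :
  pairing (G z) (x - z) - pairing (G y) (x - z) =
  bregman d G y x - bregman d G y z - bregman d G z x.
Proof. by rewrite /bregman !pairingB; ring. Qed.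

(* One inclusion of the sum rule for subdifferentials: as [V[y]] is
   differentiable at [z], its gradient may be subtracted from [h]. *)
Lemma subdifferential_sub_bregman Q d G Psi (M : R) y z (h : dual E) :
  convex_set Q -> C1_relint Q d G -> convex_function Q Psi -> 0 <= M ->
  relint Q z ->
  subdifferential Q (fun x => Psi x + M * bregman d G y x) z h ->
  exists2 g, subdifferential Q Psi z g &
    forall v, pairing g v =
      pairing h v - M * (pairing (G z) v - pairing (G y) v).
Proof.
move=> Qconv dG Pconv M0 riz hsub; have Qz : Q z by case: riz.
pose g : 'Hom(E, R^o) :=
  (h : 'Hom(E, R^o)) - M *: ((G z : 'Hom(E, R^o)) - (G y : 'Hom(E, R^o))).
have gE v : pairing g v = pairing h v - M * (pairing (G z) v - pairing (G y) v).
  by rewrite /pairing /g !(add_lfunE, opp_lfunE, scale_lfunE).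
exists g => // x Qx; rewrite gE; apply/ler_addgt0Pr => e e0.
(* The error in expanding [d] gets multiplied by [M]; tolerance [e / (M + 1)] absorbs this and also
   covers [M = 0]. *)
have M1 : 0 < M + 1 by rewrite ltr_wpDl.
have [t /andP[t0 t1] dt] :=
  C1_relint_segment Qconv dG riz Qx (divr_gt0 e0 M1).
have t01 : 0 <= t <= 1 by rewrite (ltW t0).
have := hsub _ (convex_set_segment Qconv Qx Qz t01).
have := convex_function_segment Pconv Qx Qz t01.
move: dt; rewrite ler_norml => /andP[_ /(ler_wpM2l M0) dt].
have Me : M * (e / (M + 1) * t) <= e * t.
  rewrite mulrA ler_pM2r // mulrA ler_pdivrMr // mulrC ler_pM2l //.
  by rewrite lerDl.
rewrite /bregman [_ + _ *: _ - z]addrAC subrr add0r.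
have -> : z + t *: (x - z) - y = t *: (x - z) + (z - y).
  by rewrite addrAC addrC.
rewrite pairingZ [pairing _ (_ *: _ + _)]pairingD pairingZ => Ple hle; rewrite -(ler_pM2l t0).
by move: dt Ple hle Me; lra.
Qed.

(** Subtracting the gradient of [M * V[y]] from the approximate optimality certificate [h] leaves a
    subgradient of [psi] at [z]. The strong inequality applies to it, and the three-point identity
    rewrites the gradient difference in Bregman terms. *)
Lemma inexact_argmin_bregman Q d G (psi : E -> R) (M m dt : R) x y z :
  convex_set Q -> C1_relint Q d G -> convex_function Q psi -> 0 <= M ->
  relint Q z ->
  inexact_argmin Q (fun x => psi x + M * bregman d G y x) dt z ->
  (forall g, subdifferential Q psi z g ->
     psi z + pairing g (x - z) + m * bregman d G z x <= psi x) ->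
  Q x ->
  psi z + M * bregman d G y z <=
    psi x + M * bregman d G y x - (M + m) * bregman d G z x + dt.
Proof.
move=> Qconv dG Pconv M0 riz [_ [h hsub hdt]] strong Qx.
have [g gsub gE] :=
  subdifferential_sub_bregman Qconv dG Pconv M0 riz hsub.
have := strong g gsub; have := hdt x Qx.
rewrite gE (bregman_three_point d); lra.
Qed.

(** Both [psi] and the divergence vanish when the model is evaluated at its own base point. *)
Lemma model_value_bounds Q d G (delta L mu m : R) f fdelta psi y :
  is_model Q d G delta L mu m f fdelta psi y -> Q y ->
  fdelta y <= f y <= fdelta y + delta.
Proof.
move=> mod Qy; have := model_bounds mod Qy.
rewrite (model_diag mod Qy) bregman_diag; lra.
Qed.

Lemma agm_step_gt0 Q d G (delta dt : R) fdelta psi y (Ly : R) z (Lz : R) :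
  agm_step Q d G delta dt fdelta psi y Ly z Lz -> 0 < Ly -> 0 < Lz.
Proof. by case=> i [u [_ _ _ _ ->]] Ly0; rewrite mulr_gt0 // exprz_gt0. Qed.

Lemma agm_step_descent Q d G (delta L mu m dt : R) f fdelta psi
    y (Ly : R) z (Lz : R) x :
  convex_set Q -> C1_relint Q d G ->
  is_model Q d G delta L mu m f fdelta psi y ->
  0 < Ly -> relint Q z ->
  agm_step Q d G delta dt fdelta psi y Ly z Lz -> Q x ->
  (Lz + m) * bregman d G z x <=
    (Lz - mu) * bregman d G y x + (f x - fdelta z) + dt + delta.
Proof.
move=> Qconv dG mod Ly0 riz step Qx.
have Lz0 := agm_step_gt0 step Ly0.
case: step => i [u [/(_ i (leqnn i)) + acc _ uz LzE]].
rewrite /= -LzE -uz in acc * => zmin.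
have := inexact_argmin_bregman Qconv dG
  (model_convex mod) (ltW Lz0) riz zmin (fun g => model_strong mod Qx riz) Qx.
have := model_bounds mod Qx; move: acc; lra.
Qed.

End bregman_model.

Theorem theorem3p1 (R : realType) (E : normedVectType R) (Q : set E)
    (d : E -> R) (gradd : E -> dual E)
    (f fdelta : E -> R) (psi : E -> E -> R)
    (delta L mu m dt : R)
    (xstar : E) (x : nat -> E) (Ls : nat -> R) (N j : nat)
    (Q_convex : convex_set Q)
    (d_convex : convex_function Q d)
    (d_C1 : C1_relint Q d gradd)
    (delta_ge0 : 0 <= delta) (L_ge0 : 0 <= L) (mu_ge0 : 0 <= mu)
    (m_ge0 : 0 <= m) (dt_ge0 : 0 <= dt)
    (model : forall y, relint Q y ->
       is_model Q d gradd delta L mu m f fdelta psi y)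
    (xstar_in : Q xstar)
    (xstar_min : forall z, Q z -> f xstar <= f z)
    (N_ge1 : (1 <= N)%N)
    (run : agm_run Q d gradd delta dt fdelta psi x Ls N)
    (j_range : (1 <= j <= N)%N)
    (j_argmin : forall k, (1 <= k <= N)%N -> fdelta (x j) <= fdelta (x k)) :
  f (x j) - f xstar <=
    Num.min ((Ls N + m) * qprod mu m Ls 1 N)
            (1 / \sum_(1 <= i < N.+1) 1 / (Ls i + m))
      * bregman d gradd (x 0%N) xstar + dt + 3 * delta
  /\
  bregman d gradd (x N) xstar <=
    qprod mu m Ls 1 N * bregman d gradd (x 0%N) xstar
    + (dt + 2 * delta) *
      \sum_(1 <= i < N.+1) qprod mu m Ls i.+1 N / (Ls i + m).
Proof.
have mod_at k : (k <= N)%N -> is_model Q d gradd delta L mu m f fdelta psi (x k).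
  by move=> leN; case: run => _ + _ => /(_ _ leN) /model.
case: run => Ls0 rix steps.
have Qx k : (k <= N)%N -> Q (x k) by move=> /rix[].
have Ls_gt0 k : (k <= N)%N -> 0 < Ls k.
  elim: k => // k IH ltkN.
  exact: agm_step_gt0 (steps k ltkN) (IH (ltnW ltkN)).
have a_gt0 k : (k <= N)%N -> 0 < Ls k + m by move=> /Ls_gt0 Lk; rewrite ltr_wpDr.
pose V k := bregman d gradd (x k) xstar.
have V_ge0 k : (k <= N)%N -> 0 <= V k.
  by move=> /rix rixk; exact: bregman_ge0 Q_convex d_convex d_C1 rixk xstar_in.
pose q := qfactor mu m Ls.
have q_ge0 k : (k <= N)%N -> 0 <= q k.
  move=> /a_gt0 ak; rewrite /q /qfactor; case: ifP => // muL.
  by rewrite divr_ge0 ?ltW // subr_gt0.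
have q_le1 k : (k <= N)%N -> q k <= 1.
  move=> /a_gt0 ak; rewrite /q /qfactor; case: ifP => // _.
  by rewrite ler_pdivrMr // mul1r lerD2l; lra.
(* Stated for any bound [c] on the source term, because the two conclusions use different bounds. *)
have descent c : (forall k, (1 <= k <= N)%N -> f xstar - fdelta (x k) + dt + delta <= c) ->
    forall k, (k < N)%N -> V k.+1 <= q k.+1 * V k + c / (Ls k.+1 + m).
  move=> c_ub k ltkN; have ak := a_gt0 _ ltkN.
  have step := agm_step_descent Q_convex d_C1
    (mod_at k (ltnW ltkN)) (Ls_gt0 k (ltnW ltkN)) (rix _ ltkN) (steps k ltkN) xstar_in.
  have Lmu : (Ls k.+1 - mu) * V k <= (Ls k.+1 + m) * (q k.+1 * V k).
    rewrite mulrA ler_wpM2r ?V_ge0 ?(ltnW ltkN) // /q /qfactor.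
    case: ltP => [_|Lmu]; first by rewrite mulrC divfK ?gt_eqF.
    (* Here [Ls k.+1 <= mu]: the coefficient of [V k] is nonpositive, so [q k.+1 = 0] still gives an
       upper bound. *)
    by rewrite mulr0 subr_le0.
  have ac : (Ls k.+1 + m) * (c / (Ls k.+1 + m)) = c by rewrite mulrC divfK ?gt_eqF.
  rewrite -(ler_pM2l ak) [leRHS]mulrDr ac.
  by have := c_ub k.+1 ltkN; move: step Lmu; rewrite -!/(V _); lra.
have q_ge0S k : (k < N)%N -> 0 <= q k.+1 by exact: q_ge0.
split; last first.
  have c_ub k : (1 <= k <= N)%N -> f xstar - fdelta (x k) + dt + delta <= dt + 2 * delta.
    move=> /andP[_ leN]; have := model_value_bounds (mod_at k leN) (Qx k leN).
    by have := xstar_min _ (Qx k leN); lra.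
  have := discrete_gronwall (s := fun i => (dt + 2 * delta) / (Ls i + m))
    q_ge0S (descent _ c_ub).
  rewrite big_distrr /= => /le_trans; apply; rewrite lerD2l.
  rewrite le_eqVlt; apply/orP; left; apply/eqP.
  by apply: eq_bigr => i _; rewrite mulrCA.
have /andP[j1 jN] := j_range.
have := model_value_bounds (mod_at j jN) (Qx j jN).
move=> /andP[_ fj].
(* It remains to bound [c], as [f (x j) - f xstar <= c + dt + 2 * delta]. By the choice of [j],
   every source term is at most [- c]. *)
pose c := fdelta (x j) - f xstar - dt - delta.
have c_ub k : (1 <= k <= N)%N -> f xstar - fdelta (x k) + dt + delta <= - c.
  by move=> /j_argmin; rewrite /c; lra.
have VS := descent _ c_ub.
have V0 := V_ge0 0%N isT; have VN := V_ge0 N (leqnn N).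
suff : c <= Num.min ((Ls N + m) * qprod mu m Ls 1 N)
            (1 / \sum_(1 <= i < N.+1) 1 / (Ls i + m)) * V 0%N.
  by rewrite /c -/(V 0%N); lra.
have inv_ge0 i : (i <= N)%N -> 0 <= 1 / (Ls i + m).
  by move=> leN; rewrite divr_ge0 // ltW // a_gt0.
have sum_gt0 : 0 < \sum_(1 <= i < N.+1) 1 / (Ls i + m).
  rewrite big_nat_recr //= ltr_wpDl ?divr_gt0 ?a_gt0 //.
  rewrite big_nat sumr_ge0 // => i /andP[_ ltN]; exact/inv_ge0/ltnW.
have Q_ge0 i : 0 <= \prod_(i <= k < N.+1) q k.
  by rewrite big_nat prodr_ge0 // => k /andP[_]; exact: q_ge0.
rewrite minr_pMl // le_min; apply/andP; split; last first.
  (* With [q] replaced by 1 the recursion telescopes: [c] times the sum of [1 / (Ls i + m)] is at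
     most [V 0 - V N <= V 0]. *)
  have VS1 k : (k < N)%N -> V k.+1 <= 1 * V k + - c / (Ls k.+1 + m).
    move=> ltkN; apply: (le_trans (VS k ltkN)); rewrite lerD2r.
    by rewrite ler_wpM2r ?q_le1 // V_ge0 // ltnW.
  have := discrete_gronwall (q := fun=> 1) (s := fun i => - c / (Ls i + m))
    (fun _ _ => ler01) VS1.
  rewrite big1 // mul1r.
  under eq_bigr do rewrite big1 // mul1r -[- c]mulr1 -mulrA.
  rewrite -big_distrr /= => VNle; rewrite [1 / _ * _]mulrC mulrA mulr1 ler_pdivlMr //.
  by move: VNle VN; lra.
have [c0|c0] := leP c 0.
  apply: (le_trans c0); apply: mulr_ge0 => //; apply: mulr_ge0; last exact: Q_ge0.
  exact/ltW/a_gt0.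
have := discrete_gronwall (s := fun i => - c / (Ls i + m)) q_ge0S VS.
rewrite [\sum_(1 <= i < N.+1) _]big_nat_recr //= [\prod_(N.+1 <= k < N.+1) q k]big_geq //.
rewrite mul1r => VNle.
have tail : \sum_(1 <= i < N) \prod_(i.+1 <= k < N.+1) q k * (- c / (Ls i + m)) <= 0.
  rewrite big_nat sumr_le0 // => i /andP[_ ltN]; apply: mulr_ge0_le0; first exact: Q_ge0.
  by rewrite mulNr oppr_le0 divr_ge0 ?ltW // a_gt0 // ltnW.
rewrite -mulrA mulrC -ler_pdivrMr ?a_gt0 //.
by move: VNle tail VN; rewrite mulNr /qprod -/q; lra.
Qed.
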